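(* Let $A$ be a $C^*$-algebra, $H$ a Hilbert $A$-module and $\xi\in H^\sharp$. Suppose there is a bounded net $\{x_\alpha\}$ in $H$ such that $\lim_\alpha\|\xi(x)-\langle x_\alpha,x\rangle\|=0$ for all $x\in H$ and such that $\xi(x_\alpha)$ converges in norm. Then there is $\eta\in H$ with $\xi=\langle\eta,\cdot\rangle$, and $\langle\eta,\eta\rangle=\lim_\alpha\xi(x_\alpha)\in A$.
   Context: Hilbert modules are right modules with $A$-valued inner product linear in the second variable; $H^\sharp$ is the space of bounded $A$-module maps $H\to A$. *)

(* Defs.v *)
From HB Require Import structures.
From mathcomp Require Import all_boot all_order all_algebra.
From mathcomp Require Import complex.
From mathcomp Require Import all_classical all_reals all_analysis.
Set Implicit Arguments. Unset Strict Implicit. Unset Printing Implicit Defensive.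
Import Order.TTheory GRing.Theory Num.Theory.
Local Open Scope ring_scope.
Local Open Scope complex_scope.

Record cstar_alg (R : realType) (A : completeNormedModType R[i]) := CstarAlg {
  cmul : A -> A -> A;
  cstar : A -> A;
  cmulA : forall x y z, cmul x (cmul y z) = cmul (cmul x y) z;
  cmulDl : forall x y z, cmul (x + y) z = cmul x z + cmul y z;
  cmulDr : forall x y z, cmul x (y + z) = cmul x y + cmul x z;
  cmulZl : forall (k : R[i]) x y, cmul (k *: x) y = k *: cmul x y;
  cmulZr : forall (k : R[i]) x y, cmul x (k *: y) = k *: cmul x y;
  cstarD : forall x y, cstar (x + y) = cstar x + cstar y;
  cstarZ : forall (k : R[i]) x, cstar (k *: x) = k^* *: cstar x;
  cstarK : forall x, cstar (cstar x) = x;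
  cstarM : forall x y, cstar (cmul x y) = cmul (cstar y) (cstar x);
  cnormM : forall x y, `|cmul x y| <= `|x| * `|y|;
  cstar_identity : forall x, `|cmul (cstar x) x| = `|x| ^+ 2
}.

Definition cpos (R : realType) (A : completeNormedModType R[i])
  (M : cstar_alg A) (a : A) : Prop :=
  exists b, a = cmul M (cstar M b) b.

Record hilbert_mod (R : realType) (A : completeNormedModType R[i])
  (M : cstar_alg A) (H : lmodType R[i]) := HilbertMod {
  ract : H -> A -> H;
  ip : H -> H -> A;
  ractA : forall x a b, ract (ract x a) b = ract x (cmul M a b);
  ractDl : forall x y a, ract (x + y) a = ract x a + ract y a;
  ractDr : forall x a b, ract x (a + b) = ract x a + ract x b;
  ractZl : forall (k : R[i]) x a, ract (k *: x) a = k *: ract x a;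
  ractZr : forall (k : R[i]) x a, ract x (k *: a) = k *: ract x a;
  ipDr : forall x y z, ip x (y + z) = ip x y + ip x z;
  ipZr : forall (k : R[i]) x y, ip x (k *: y) = k *: ip x y;
  ipMr : forall x y a, ip x (ract y a) = cmul M (ip x y) a;
  ip_adj : forall x y, ip y x = cstar M (ip x y);
  ip_pos : forall x, cpos M (ip x x);
  ip_eq0 : forall x, ip x x = 0 -> x = 0;
  hm_complete : forall u : nat -> H,
    (forall e : R[i], 0 < e -> exists N, forall m n, (N <= m)%N -> (N <= n)%N ->
        sqrtC `|ip (u m - u n) (u m - u n)| < e) ->
    exists l : H, forall e : R[i], 0 < e -> exists N, forall n, (N <= n)%N ->
        sqrtC `|ip (u n - l) (u n - l)| < e
}.

Definition hnorm (R : realType) (A : completeNormedModType R[i])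
  (M : cstar_alg A) (H : lmodType R[i]) (HM : hilbert_mod M H) (x : H) : R[i] :=
  sqrtC `|ip HM x x|.

Definition in_dual (R : realType) (A : completeNormedModType R[i])
  (M : cstar_alg A) (H : lmodType R[i]) (HM : hilbert_mod M H) (xi : H -> A) : Prop :=
  [/\ forall x y, xi (x + y) = xi x + xi y,
      forall (k : R[i]) x, xi (k *: x) = k *: xi x,
      forall x a, xi (ract HM x a) = cmul M (xi x) a &
      exists K : R[i], 0 <= K /\ forall x, `|xi x| <= K * hnorm HM x].

Record directed_set := DirectedSet {
  dI :> Type;
  dle : dI -> dI -> Prop;
  dle_refl : forall a, dle a a;
  dle_trans : forall a b c, dle a b -> dle b c -> dle a c;
  dle_directed : forall a b, exists c, dle a c /\ dle b c;
  d_inhabited : dI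
}.

Definition net_cvg (R : realType) (V : normedModType R[i]) (D : directed_set)
  (f : D -> V) (l : V) : Prop :=
  forall e : R[i], 0 < e -> exists a0 : D, forall a, dle a0 a -> `|f a - l| < e.

(* Main.v *)
(* Banach-Saks. Choose terms [x_1, x_2, ...] of the net successively so that
   each inner product [<x_j, x_i>], [i < j], is close to [xi x_i], hence to
   [L = lim xi (x_a)]. The averages [z] of [n] such terms satisfy
   [<z, z> ~ (L + L')/2], [L'] the adjoint of [L], the diagonal contributing only
   [O(1/n)]. If [z'] is an average of terms chosen after [z] then [<z', z> ~ L],
   so [<z' - z, z' - z> ~ 0]. Letting [z'] test against an arbitrary [y] shows
   that [<z, .>] approximates [xi] uniformly on the unit ball; such [z] form a
   Cauchy sequence, whose limit represents [xi].

   The argument needs the Cauchy-Schwarz inequality up to a constant, which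
   amounts to [|q|^2 <= K |p'p + q'q|] in a C*-algebra (['] the adjoint). To get
   it without functional calculus, reduce to [q = g] hermitian and set
   [s = p'p + g^2], [eps = |s|]. Norms are those of left multiplications on [A].
   - [|1 - t h^2| <= 1 + O(t^2)] for [h] hermitian, so
     [pp' = ((p + p')^2 + (i(p - p'))^2)/2 + g^2 - s] gives
     [|1 - t pp'| <= 1 + t eps + O(t^2)].
   - The powers of [1 - t p'p] grow no faster than those of [1 - t pp'], up to a
     linear factor, so the same bound holds for [1 - t p'p]; as [p'p = s - g^2],
     [|1 + t g^2| <= 1 + 2 t eps + O(t^2)].
   - [n t |g|^2 <= |1 + t g^2|^n]. Letting [n] tend to infinity with [n t]
     constant equal to [1 / (2 eps)] yields [|g|^2 <= 2 e^2 eps]. *)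

Require Import Defs.
From HB Require Import structures.
From mathcomp Require Import all_boot all_order all_algebra.
From mathcomp Require Import complex.
From mathcomp Require Import all_classical all_reals all_analysis.
From mathcomp Require Import ring lra.
Import Order.TTheory GRing.Theory Num.Theory.
Local Open Scope ring_scope.
Local Open Scope complex_scope.
Set Implicit Arguments.
Unset Strict Implicit.
Unset Printing Implicit Defensive.

(** * Reflexive normalisation of linear combinations in a module *)

Section LmodTactic.
Variables (K : comPzRingType) (V : lmodType K).

Inductive lexp :=
  | LVar of nat | LZero | LAdd of lexp & lexp | LOpp of lexp
  | LScale of K & lexp.

Fixpoint leval (env : seq V) (e : lexp) : V :=
  match e with
  | LVar i => nth 0 env i
  | LZero => 0
  | LAdd e1 e2 => leval env e1 + leval env e2
  | LOpp e1 => - leval env e1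
  | LScale k e1 => k *: leval env e1
  end.

(** The index test is [eqn], so that [cbn] can evaluate it on numerals and leave bare ring
    expressions. *)
Fixpoint lcoef (e : lexp) (n : nat) : K :=
  match e with
  | LVar i => if eqn i n then 1 else 0
  | LZero => 0
  | LAdd e1 e2 => lcoef e1 n + lcoef e2 n
  | LOpp e1 => - lcoef e1 n
  | LScale k e1 => k * lcoef e1 n
  end.

Fixpoint lcoef_eq (e1 e2 : lexp) (n : nat) : Prop :=
  if n is m.+1 then lcoef e1 m = lcoef e2 m /\ lcoef_eq e1 e2 m else True.

Lemma levalE env e :
  leval env e = \sum_(i < size env) lcoef e i *: nth 0 env i.
Proof.
elim: e => [i||e1 IH1 e2 IH2|e IH|k e IH] /=.
- case: (ltnP i (size env)) => hi; last first.
    rewrite nth_default // big1 // => j _.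
    rewrite eqnE; case: eqP => [ij|_]; last by rewrite scale0r.
    by move: (ltn_ord j); rewrite -ij ltnNge hi.
  rewrite (bigD1 (Ordinal hi)) //= eqnE eqxx scale1r big1 ?addr0 //.
  move=> j /eqP ji; case: eqP => [ij|_]; last by rewrite scale0r.
  by case: ji; apply: val_inj.
- by rewrite big1 // => j _; rewrite scale0r.
- by rewrite IH1 IH2 -big_split; apply: eq_bigr => j _; rewrite scalerDl.
- by rewrite IH -sumrN; apply: eq_bigr => j _; rewrite scaleNr.
- by rewrite IH scaler_sumr; apply: eq_bigr => j _; rewrite scalerA.
Qed.

(** Soundness of the reflection. Equality of coefficients is only sufficient, as the atoms may be
    linearly dependent. *)
Lemma leval_eq env e1 e2 :
  lcoef_eq e1 e2 (size env) -> leval env e1 = leval env e2.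
Proof.
rewrite !levalE => h; apply: eq_bigr => -[i hi] _ /=; congr (_ *: _).
elim: (size env) hi h => // n IH; rewrite ltnS leq_eqVlt => /orP[/eqP->|hi] [] //.
by move=> _; apply: IH.
Qed.

End LmodTactic.

Ltac lmod_index x l :=
  lazymatch l with
  | x :: _ => constr:(O)
  | _ :: ?l' => let n := lmod_index x l' in constr:(S n)
  end.
Ltac lmod_mem x l :=
  lazymatch l with
  | [::] => constr:(false)
  | x :: _ => constr:(true)
  | _ :: ?l' => lmod_mem x l'
  end.
Ltac lmod_atoms l e :=
  lazymatch e with
  | (?a + ?b)%R => let l1 := lmod_atoms l a in lmod_atoms l1 b
  | (- ?a)%R => lmod_atoms l a
  | (_ *: ?a)%R => lmod_atoms l a
  | 0%R => l
  | _ => lazymatch lmod_mem e l with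
         | true => l
         | false => constr:(e :: l)
         end
  end.
Ltac lmod_reify K l e :=
  lazymatch e with
  | (?a + ?b)%R => let x := lmod_reify K l a in let y := lmod_reify K l b in
                   constr:(@LAdd K x y)
  | (- ?a)%R => let x := lmod_reify K l a in constr:(@LOpp K x)
  | (?k *: ?a)%R => let x := lmod_reify K l a in constr:(@LScale K k x)
  | 0%R => constr:(@LZero K)
  | _ => let n := lmod_index e l in constr:(@LVar K n)
  end.

(* Reduces an equality in a module over [K] to the equalities of the
   coefficients of its atoms. *)
Ltac lmod K :=
  lazymatch goal with |- @eq ?T ?a ?b =>
    let l0 := lmod_atoms (@nil T) a in
    let l := lmod_atoms l0 b in
    let x := lmod_reify K l a in
    let y := lmod_reify K l b in
    apply: (@leval_eq K _ l x y); cbn [lcoef_eq lcoef eqn size];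
    repeat split
  end.

(** * Norm estimates in a C*-algebra *)

Section CstarAlgebra.
Variables (R : realType) (A : completeNormedModType R[i]) (M : cstar_alg A).
Local Notation "x *a y" := (cmul M x y) (at level 40, left associativity).
Local Notation st := (cstar M).
Implicit Types (x y z g : A).

(** * The real-valued norm and the involution *)

Definition nrm (x : A) : R := complex.Re `|x|.

Lemma normE x : `|x| = (nrm x)%:C.
Proof.
have := normr_ge0 x; rewrite lecE /nrm => /andP[/eqP /= im0 _].
by rewrite [LHS]complexE im0 mulr0 addr0.
Qed.

Lemma nrm_ge0 x : 0 <= nrm x.
Proof. by rewrite -lecR -(normE x) normr_ge0. Qed.

Lemma nrm0 : nrm 0 = 0.
Proof. by rewrite /nrm normr0. Qed.

Lemma nrm_eq0 x : nrm x = 0 -> x = 0.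
Proof. by move=> h; apply/eqP; rewrite -normr_eq0 normE h. Qed.

Lemma nrmD x y : nrm (x + y) <= nrm x + nrm y.
Proof. by rewrite -lecR rmorphD /= -!normE ler_normD. Qed.

Lemma nrmN x : nrm (- x) = nrm x.
Proof. by rewrite /nrm normrN. Qed.

Lemma nrmB x y : nrm (x - y) <= nrm x + nrm y.
Proof. by rewrite -(nrmN y) nrmD. Qed.

Lemma nrmZ (r : R) x :
  nrm (r%:C *: x) = `|r| * nrm x.
Proof.
apply: complexI; rewrite rmorphM /= -!normE normrZ; congr (_ * _).
by rewrite normc_def /= expr0n addr0 sqrtr_sqr.
Qed.

Lemma nrmZi x : nrm ('i *: x) = nrm x.
Proof. by rewrite /nrm normrZ normc_def /= expr0n add0r expr1n sqrtr1 mul1r. Qed.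

Lemma nrmM x y : nrm (x *a y) <= nrm x * nrm y.
Proof. by rewrite -lecR rmorphM /= -!normE cnormM. Qed.

Lemma nrm_star_mul x : nrm (st x *a x) = nrm x ^+ 2.
Proof. by apply: complexI; rewrite rmorphXn /= -!normE cstar_identity. Qed.

Lemma nrm_star x : nrm (st x) = nrm x.
Proof.
have le_star z : nrm z <= nrm (st z).
  have [->|z0] := eqVneq (nrm z) 0; first exact: nrm_ge0.
  have zp : 0 < nrm z by rewrite lt_def z0 nrm_ge0.
  by rewrite -(ler_pM2r zp) -expr2 -nrm_star_mul nrmM.
by apply/eqP; rewrite eq_le le_star -{2}(cstarK M x) le_star.
Qed.

Lemma cstar0 : st 0 = 0.
Proof. by apply: (addrI (st 0)); rewrite -cstarD !addr0. Qed.

Lemma cstarN x : st (- x) = - st x.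
Proof. by apply: (addrI (st x)); rewrite -cstarD !subrr cstar0. Qed.

Lemma cmulN x y : x *a - y = - (x *a y).
Proof. by rewrite -scaleN1r cmulZr scaleN1r. Qed.

Lemma cmulNl x y : - x *a y = - (x *a y).
Proof. by rewrite -scaleN1r cmulZl scaleN1r. Qed.

Lemma cstarZr (r : R) x : st (r%:C *: x) = r%:C *: st x.
Proof. by rewrite cstarZ; congr (_ *: _); exact: conjc_real. Qed.

Lemma cstarZi x : st ('i *: x) = - ('i *: st x).
Proof.
rewrite cstarZ -scaleNr; congr (_ *: _); rewrite -[LHS]/(conjc 'i).
by apply/eqP; rewrite eq_complex /= oppr0 !eqxx.
Qed.

(** Expands products into left-associated monomials and pushes stars to the atoms, the form on which
    [lmod] works. *)
Definition cE := (cmulDl M, cmulDr M, cmulN, cmulNl, cmulZl M, cmulZr M, cmulA M,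
  cstarD M, cstarN, cstarZr, cstarZi, cstarM M, cstarK M).

(** The C*-identity with [|st y| = |y|]. In use [x = T y] and [z = T'T y] with [T'] the adjoint of
    [T], so a bound for [T'T] yields one for [T]. *)
Lemma nrm_sqr_le x y z : st x *a x = st y *a z -> nrm x ^+ 2 <= nrm y * nrm z.
Proof. by move=> e; rewrite -nrm_star_mul e (le_trans (nrmM _ _)) // nrm_star. Qed.

Lemma mulii : 'i * 'i = - 1 :> R[i].
Proof. by rewrite -expr2 sqr_i. Qed.

(* [w = 1 + 2 i g - 2 g^2] is unitary up to fourth order, [w^* w = 1 + 4 g^4],
   and its real part is [1 - 2 g^2]. *)
Lemma nrm_sub_square g y : st g = g ->
  nrm (y - (2 : R)%:C *: (g *a g *a y)) <= (1 + 2 * nrm g ^+ 4) * nrm y.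
Proof.
move=> hg.
pose w (t : R) := y + t%:C *: ('i *: (g *a y)) - (2 : R)%:C *: (g *a g *a y).
have ww t : t ^+ 2 = 4 -> st (w t) *a w t =
    st y *a (y + (4 : R)%:C *: (g *a (g *a (g *a (g *a y))))).
  move=> t2; rewrite /w !cE !hg.
  have tt : t%:C * t%:C = 4 :> R[i] by rewrite -rmorphM -expr2 t2 rmorph_nat.
  have tt4 : (2 : R)%:C = 2 :> R[i] by rewrite rmorph_nat.
  have tt5 : (4 : R)%:C = 4 :> R[i] by rewrite rmorph_nat.
  have ii := mulii.
  rewrite tt4 tt5; lmod R[i]; try ring; ring: tt ii.
have nw t : t ^+ 2 = 4 -> nrm (w t) <= (1 + 2 * nrm g ^+ 4) * nrm y.
  move=> /ww /nrm_sqr_le h; have y0 := nrm_ge0 y; have g0 := nrm_ge0 g.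
  have c0 : 0 <= 1 + 2 * nrm g ^+ 4 by rewrite addr_ge0 // mulr_ge0 ?exprn_ge0.
  rewrite -(@ler_pXn2r _ 2) ?nnegrE ?nrm_ge0 ?mulr_ge0 //.
  apply: (le_trans h); rewrite exprMn [X in _ <= X]mulrC expr2 -mulrA ler_wpM2l //.
  apply: (le_trans (nrmD _ _)); rewrite nrmZ ger0_norm //.
  have -> : nrm y * (1 + 2 * nrm g ^+ 4) ^+ 2 =
    nrm y + 4 * (nrm g * (nrm g * (nrm g * (nrm g * nrm y)))) +
    4 * nrm g ^+ 8 * nrm y by ring.
  rewrite -[X in X <= _]addr0 lerD // ?mulr_ge0 ?exprn_ge0 // lerD2l ler_wpM2l //.
  by do 4 (apply: (le_trans (nrmM _ _)); apply: ler_wpM2l => //).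
(* The values 2 and -2 of [t] give mutually adjoint multipliers; their average cancels the term in
   [i g]. *)
have -> : y - (2 : R)%:C *: (g *a g *a y) = (2^-1 : R)%:C *: (w 2 + w (- 2)).
  by rewrite /w rmorphN fmorphV rmorph_nat; lmod R[i]; field.
rewrite nrmZ ger0_norm ?invr_ge0 // mulrC ler_pdivrMr //.
apply: (le_trans (nrmD _ _)).
have := nw 2 ltac:(ring); have := nw (-2) ltac:(ring); lra.
Qed.

(** * Growth of powers of self-adjoint operators *)

(** The ratios of a log-convex sequence do not decrease, so a first ratio [r > rho] forces growth at
    least like [r ^ n], which beats [rho ^ n] times a linear factor. *)
Lemma log_convex_ratio_le (u : nat -> R) (C rho : R) :
  (forall n, 0 <= u n) -> (forall n, u n.+1 ^+ 2 <= u n * u n.+2) ->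
  0 <= C -> 0 < rho -> (forall n, u n <= (1 + n%:R * C) * rho ^+ n * u 0%N) ->
  u 1%N <= rho * u 0%N.
Proof.
move=> u0 lc C0 rho0 ub; rewrite leNgt; apply/negP => h.
have u00 : 0 < u 0%N.
  rewrite lt_def u0 andbT; apply/eqP => e.
  by move: h (ub 1%N); rewrite e !mulr0 => /lt_le_trans hh /hh; rewrite ltxx.
pose r := u 1%N / u 0%N.
have rrho : rho < r by rewrite ltr_pdivlMr.
have r0 : 0 < r by apply: lt_trans rrho.
have step n : 0 < u n /\ r * u n <= u n.+1.
  elim: n => [|n [un IH]]; first by split=> //; rewrite /r divfK ?gt_eqF.
  have un1 : 0 < u n.+1 by apply: lt_le_trans IH; rewrite mulr_gt0.
  split=> //; rewrite -(ler_pM2l un); apply: le_trans (lc n).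
  by rewrite mulrA (mulrC _ r) expr2 ler_pM2r.
have geo n : r ^+ n * u 0%N <= u n.
  elim: n => [|n IH]; first by rewrite mul1r.
  by apply: le_trans (proj2 (step n)); rewrite exprS -mulrA ler_pM2l.
pose x := r / rho - 1.
have x0 : 0 < x by rewrite subr_gt0 ltr_pdivlMr // mul1r.
have q n : (1 + x) ^+ n <= 1 + n%:R * C.
  rewrite /x addrC subrK expr_div_n ler_pdivrMr ?exprn_gt0 //.
  by rewrite -(ler_pM2r u00); apply: le_trans (geo n) (ub n).
(* At exponent [2 m] the square of Bernoulli's inequality is quadratic in [m], while the right side
   of [q] is linear. *)
have q2 (m : nat) : m%:R * x ^+ 2 <= 2 * C.
  case: m => [|m]; first by rewrite mul0r mulr_ge0.
  have m0 : 0 < m.+1%:R :> R by rewrite ltr0n.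
  have bern : 1 + m.+1%:R * x <= (1 + x) ^+ m.+1.
    elim: (m.+1) => [|k IH]; first by rewrite mul0r addr0.
    rewrite exprS; apply: (@le_trans _ _ ((1 + x) * (1 + k%:R * x))).
      by rewrite -natr1; have := mulr_ge0 (ler0n R k) (sqr_ge0 x); nra.
    by rewrite ler_pM2l //; lra.
  have b0 : 0 <= 1 + m.+1%:R * x by rewrite addr_ge0 // mulr_ge0 // ltW.
  have := q (m.+1 * 2)%N; rewrite exprM natrM => h2.
  have : (1 + m.+1%:R * x) ^+ 2 <= 1 + m.+1%:R * 2 * C.
    by apply: le_trans h2; rewrite ler_pXn2r ?nnegrE // (le_trans b0).
  move=> h3; rewrite -(ler_pM2l m0); have := mulr_gt0 m0 x0; nra.
have := archi_boundP (mulr_ge0 (ler0n R 2) (divr_ge0 C0 (sqr_ge0 x))).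
rewrite ltNge => /negP; apply; rewrite mulrA ler_pdivlMr ?exprn_gt0 //.
Qed.

(** One-vector form of the equality of norm and spectral radius for self-adjoint [T]: the norms of
    [T^n y] are log-convex. *)
Lemma hermitian_op_bound (T : A -> A) (C rho : R) y :
  (forall x z, st (T x) *a z = st x *a T z) -> 0 <= C -> 0 < rho ->
  (forall n, nrm (iter n T y) <= (1 + n%:R * C) * rho ^+ n * nrm y) ->
  nrm (T y) <= rho * nrm y.
Proof.
move=> hT C0 rho0 ub.
apply: (@log_convex_ratio_le (fun n => nrm (iter n T y)) C) => // n.
  exact: nrm_ge0.
by apply: nrm_sqr_le; rewrite !iterS hT.
Qed.

(* With [Q] the adjoint of [P], [(1 - QP)^n = 1 - \sum_(j < n) Q (1 - PQ)^j P]
   is bounded by [rho^n] up to a factor linear in [n]. *)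
Lemma nrm_sub_star_mul (P : A) (rho : R) : 1 <= rho ->
  (forall z, nrm (z - P *a st P *a z) <= rho * nrm z) ->
  forall y, nrm (y - st P *a P *a y) <= rho * nrm y.
Proof.
move=> rho1 hS y; have rho0 : 0 < rho by apply: lt_le_trans rho1.
pose T z := z - st P *a P *a z; pose S z := z - P *a st P *a z.
have PT n : P *a iter n T y = iter n S (P *a y).
  by elim: n => // n IH; rewrite !iterS -IH {1}/T {1}/S !cE.
have Sn n z : nrm (iter n S z) <= rho ^+ n * nrm z.
  elim: n => [|n IH]; first by rewrite mul1r.
  rewrite iterS exprS -mulrA; apply: (le_trans (hS _)).
  by rewrite ler_pM2l.
have P0 := nrm_ge0 P; have y0 := nrm_ge0 y.
apply: (@hermitian_op_bound T (nrm P ^+ 2)) => //.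
- by move=> x z; rewrite /T !cE.
- exact: sqr_ge0.
elim=> [|n IH]; first by rewrite mul0r addr0 !mul1r.
(* One more power subtracts [P' S^n P y] ([P'] the adjoint of [P]), of norm at most
   [|P|^2 rho^n |y|]; [1 <= rho] then raises the exponent to [n + 1]. *)
rewrite iterS {1}/T -cmulA PT; apply: (le_trans (nrmB _ _)).
have : nrm (st P *a iter n S (P *a y)) <= nrm P ^+ 2 * (rho ^+ n.+1 * nrm y).
  apply: (le_trans (nrmM _ _)); rewrite nrm_star expr2 -mulrA ler_wpM2l //.
  apply: (le_trans (Sn _ _)); rewrite mulrCA.
  apply: (@le_trans _ _ (rho ^+ n * (nrm P * nrm y))).
    by rewrite ler_wpM2l ?nrmM // exprn_ge0 // ltW.
  rewrite ler_wpM2r ?mulr_ge0 //.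
  by rewrite exprS ler_peMl // exprn_ge0 // ltW.
have : (1 + n%:R * nrm P ^+ 2) * rho ^+ n * nrm y <=
       (1 + n%:R * nrm P ^+ 2) * rho ^+ n.+1 * nrm y.
  rewrite ler_wpM2r // ler_wpM2l ?addr_ge0 ?mulr_ge0 ?sqr_ge0 //.
  by rewrite exprS ler_peMl // exprn_ge0 // ltW.
rewrite -natr1; nra.
Qed.

(** * Powers of [1 + i g] for hermitian [g] *)

Definition cayley g y := y + 'i *: (g *a y).

Lemma cayleyM g y z : st g = g -> st (cayley g y) *a z = st y *a (z - 'i *: (g *a z)).
Proof. by move=> hg; rewrite /cayley !cE hg; lmod R[i]; ring. Qed.

(** The operators [1 + i g] and [1 - i g] are adjoint and commute: both squared norms equal the norm
    of [y' (1 + g^2) y], with [y'] the adjoint of [y]. *)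
Lemma nrm_cayley_conj g y : st g = g -> nrm (y - 'i *: (g *a y)) = nrm (cayley g y).
Proof.
move=> hg; apply/eqP; rewrite -(@eqrXn2 _ 2) ?nrm_ge0 // -!nrm_star_mul.
apply/eqP; congr (nrm _); rewrite cayleyM // /cayley !cE hg; lmod R[i]; ring.
Qed.

(* Averaging [b ((d-1) y + n i g y)] and [a ((d+1) y + n i g y)], where
   [a, b = 1 +- i g], replaces [n] by [n+1], and [|a z| = |b z|]. *)
Lemma nrm_cayley_iter_lower g (n : nat) (r d : R) y : st g = g -> 0 < r ->
  nrm (d%:C *: y + (n%:R : R)%:C *: ('i *: (g *a y))) <=
  ((d ^+ 2 + n%:R) / r + r) / 2 * nrm (iter n (cayley g) y).
Proof.
move=> hg r0; elim: n d y => [|n IH] d y.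
  (* AM-GM replaces [|d|] by a quadratic in [d], which behaves well under the averaging over [d - 1]
     and [d + 1]. *)
  rewrite scale0r addr0 nrmZ addr0 /= ler_wpM2r ?nrm_ge0 //.
  rewrite ler_pdivlMr // -subr_ge0.
  have -> : d ^+ 2 / r + r - `|d| * 2 = (`|d| - r) ^+ 2 / r.
    by rewrite -(real_normK (num_real d)); field; rewrite gt_eqF.
  by rewrite divr_ge0 ?sqr_ge0 ?ltW.
pose f (d : R) z := d%:C *: z + (n%:R : R)%:C *: ('i *: (g *a z)).
have fc c z : cayley g (f c z) = f c (cayley g z).
  by rewrite /f /cayley !cE; lmod R[i]; ring.
have -> : d%:C *: y + (n.+1%:R : R)%:C *: ('i *: (g *a y)) = (2^-1 : R)%:C *:
    ((f (d - 1) y - 'i *: (g *a f (d - 1) y)) + cayley g (f (d + 1) y)).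
  rewrite /f /cayley !cE fmorphV rmorph_nat -natr1 !rmorphD rmorphN rmorph1.
  by lmod R[i]; field.
rewrite nrmZ ger0_norm ?invr_ge0 // mulrC ler_pdivrMr //.
apply: (le_trans (nrmD _ _)); rewrite nrm_cayley_conj // !fc.
apply: (le_trans (lerD (IH _ _) (IH _ _))); rewrite -iterSr -mulrDl mulrAC.
(* The mean of [(d - 1)^2] and [(d + 1)^2] is [d^2 + 1], which turns [n] into [n + 1] exactly. *)
rewrite ler_wpM2r ?nrm_ge0 // -natr1 le_eqVlt; apply/orP; left; apply/eqP.
by field; rewrite gt_eqF.
Qed.

(** Compares two bounds for [(1 + i g)^n g]: its squared norm is at most [rho^n |g|^2], and at least
    [n |g|^4] by the lower bound with [d = 0]. *)
Lemma nrm_sqr_le_of_add_square g (rho : R) (n : nat) : st g = g -> 0 <= rho ->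
  (forall y, nrm (y + g *a g *a y) <= rho * nrm y) ->
  n%:R * nrm g ^+ 2 <= rho ^+ n.
Proof.
move=> hg rho0 hrho; have g0 := nrm_ge0 g.
have a1 y : nrm (cayley g y) ^+ 2 <= rho * nrm y ^+ 2.
  apply: (@le_trans _ _ (nrm y * nrm (y + g *a g *a y))).
    apply: nrm_sqr_le; rewrite cayleyM // /cayley !cE.
    by lmod R[i]; try ring; ring: mulii.
  by rewrite expr2 mulrCA ler_wpM2l ?nrm_ge0.
have an k y : nrm (iter k (cayley g) y) ^+ 2 <= rho ^+ k * nrm y ^+ 2.
  elim: k => [|k IH]; first by rewrite mul1r.
  by apply: (le_trans (a1 _)); rewrite (exprS rho) -mulrA ler_wpM2l.
case: n => [|n]; first by rewrite mul0r.
have [->|g1] := eqVneq (nrm g) 0; first by rewrite expr0n mulr0 exprn_ge0.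
have gp : 0 < nrm g by rewrite lt_def g1.
set N : R := n.+1%:R; have N0 : 0 < N by rewrite ltr0n.
(* The value of [r] that minimises [(N / r + r) / 2]. *)
pose r := Num.sqrt N; have r0 : 0 < r by rewrite sqrtr_gt0.
have rr : r ^+ 2 = N by rewrite sqr_sqrtr // ltW.
have := nrm_cayley_iter_lower n.+1 0 g hg r0; rewrite -/N.
rewrite scale0r add0r expr0n add0r nrmZ nrmZi (ger0_norm (ltW N0)).
have -> : (N / r + r) / 2 = r by rewrite -rr; field; rewrite gt_eqF.
have -> : nrm (g *a g) = nrm g ^+ 2 by rewrite -{1}hg nrm_star_mul.
move=> h.
have {}h : r * nrm g ^+ 2 <= nrm (iter n.+1 (cayley g) g).
  by rewrite -(ler_pM2l r0) mulrA -expr2 rr.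
rewrite -rr -(ler_pM2r (exprn_gt0 2 gp)); apply: le_trans (an _ _).
have -> : r ^+ 2 * nrm g ^+ 2 * nrm g ^+ 2 = (r * nrm g ^+ 2) ^+ 2 by ring.
by rewrite ler_pXn2r ?nnegrE ?nrm_ge0 ?mulr_ge0 ?sqr_ge0 // ltW.
Qed.

(** The error is quartic and the main term quadratic in [(P, g)], so rescaling the pair makes the
    error negligible. The factor 16 comes from [|u|, |v| <= 2 |P|]; the second [|s|] is paid on
    returning from [1 - P'P] to [1 + g^2]. *)
Lemma nrm_add_square (P g : A) y : st g = g ->
  nrm (y + g *a g *a y) <=
  (1 + (16 * nrm P ^+ 4 + nrm g ^+ 4) + 2 * nrm (st P *a P + g *a g)) * nrm y.
Proof.
move=> hg; set s := st P *a P + g *a g.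
pose rho := 1 + (16 * nrm P ^+ 4 + nrm g ^+ 4) + nrm s.
have P4 := exprn_ge0 4 (nrm_ge0 P); have g4 := exprn_ge0 4 (nrm_ge0 g).
have s0 := nrm_ge0 s.
have rho1 : 1 <= rho by rewrite /rho; lra.
pose u := P + st P; pose v := 'i *: (P - st P).
have hu : st u = u by rewrite /u !cE addrC.
have hv : st v = v by rewrite /v !cE; lmod R[i]; ring.
have double4 z : nrm z <= 2 * nrm P -> nrm z ^+ 4 <= 16 * nrm P ^+ 4.
  move=> h; have -> : 16 * nrm P ^+ 4 = (2 * nrm P) ^+ 4 by ring.
  by rewrite ler_pXn2r ?nnegrE ?nrm_ge0 ?mulr_ge0 // nrm_ge0.
have u4 : nrm u ^+ 4 <= 16 * nrm P ^+ 4.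
  by apply: double4; apply: (le_trans (nrmD _ _)); rewrite nrm_star; lra.
have v4 : nrm v ^+ 4 <= 16 * nrm P ^+ 4.
  by apply: double4; rewrite nrmZi; apply: (le_trans (nrmB _ _)); rewrite nrm_star; lra.
have hS z : nrm (z - P *a st P *a z) <= rho * nrm z.
  have z0 := nrm_ge0 z.
  have -> : z - P *a st P *a z =
      (4^-1 : R)%:C *: (z - (2 : R)%:C *: (u *a u *a z)) +
      (4^-1 : R)%:C *: (z - (2 : R)%:C *: (v *a v *a z)) +
      (2^-1 : R)%:C *: (z - (2 : R)%:C *: (g *a g *a z)) + s *a z.
    rewrite /s /u /v !cE !fmorphV !rmorph_nat.
    have ii := mulii; lmod R[i]; first [by field | by field: ii].
  apply: (le_trans (nrmD _ _)); apply: (le_trans (lerD (nrmD _ _) (nrmM _ _))).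
  apply: (le_trans (lerD (lerD (nrmD _ _) (lexx _)) (lexx _))).
  rewrite !nrmZ !ger0_norm ?invr_ge0 //.
  have := nrm_sub_square z hu; have := nrm_sub_square z hv.
  have := nrm_sub_square z hg.
  have := ler_wpM2r z0 u4; have := ler_wpM2r z0 v4.
  rewrite /rho; lra.
have -> : y + g *a g *a y = (y - st P *a P *a y) + s *a y.
  by rewrite /s !cE; lmod R[i]; ring.
apply: (le_trans (nrmD _ _)).
have := nrm_sub_star_mul rho1 hS y; have := nrmM s y; rewrite /rho; lra.
Qed.

(** * Domination of [|q|^2] by the norm of [p'p + q'q] *)

Definition cs_const : R := 2 * expR 2.

Lemma cs_const_gt0 : 0 < cs_const.
Proof. by rewrite mulr_gt0 // expR_gt0. Qed.

Lemma nrm_hermitian_le (P g : A) : st g = g ->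
  nrm g ^+ 2 <= cs_const * nrm (st P *a P + g *a g).
Proof.
move=> hg.
(* A strictly positive upper bound [e] allows division even when the norm vanishes. *)
suff key (e : R) : 0 < e -> nrm (st P *a P + g *a g) <= e -> nrm g ^+ 2 <= cs_const * e.
  set s := nrm _ in key *; apply/ler_addgt0Pr => d d0.
  have := key (s + d / cs_const); rewrite mulrDr mulrCA divff ?gt_eqF ?cs_const_gt0 // mulr1.
  have dk : 0 < d / cs_const by rewrite divr_gt0 ?cs_const_gt0.
  by apply; [rewrite ltr_pwDr ?nrm_ge0 | rewrite lerDl ltW].
move=> e0 se.
pose C := 16 * nrm P ^+ 4 + nrm g ^+ 4.
have C0 : 0 <= C by rewrite addr_ge0 ?mulr_ge0 ?exprn_ge0 ?nrm_ge0.
(* With [s = 1 / (2 e n)], this [n] makes the quartic error [s^2 C] at most [1 / n]; the main term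
   [2 s e] equals [1 / n]. One such [n] suffices, since [(1 + 2 / n)^n] is at most [expR 2]. *)
pose n := (Num.bound (C / (4 * e ^+ 2))).+1.
have n0 : 0 < n%:R :> R by rewrite ltr0n.
have Cn : C / (4 * e ^+ 2) <= n%:R.
  apply: (@le_trans _ _ (Num.bound (C / (4 * e ^+ 2)))%:R); last by rewrite ler_nat.
  by apply: ltW; apply: archi_boundP; apply: divr_ge0 => //; apply: mulr_ge0 => //; exact: sqr_ge0.
pose s := (2 * e * n%:R)^-1.
have s0 : 0 < s by rewrite invr_gt0 !mulr_gt0.
pose t := Num.sqrt s; have tt : t ^+ 2 = s by rewrite sqr_sqrtr // ltW.
have t0 : 0 <= t by rewrite sqrtr_ge0.
have ht : st (t%:C *: g) = t%:C *: g by rewrite cstarZr hg.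
have t4 : t ^+ 4 = s ^+ 2 by rewrite -tt -exprM.
have rho0 : 0 <= 1 + (2 / n%:R) :> R by rewrite addr_ge0 // divr_ge0.
have := @nrm_sqr_le_of_add_square _ (1 + 2 / n%:R) n ht rho0 _.
rewrite nrmZ (ger0_norm t0) exprMn tt => h.
have {}h : n%:R * (s * nrm g ^+ 2) <= (1 + 2 / n%:R) ^+ n.
  apply: h => y; apply: (le_trans (nrm_add_square (t%:C *: P) y ht)).
  rewrite ler_wpM2r ?nrm_ge0 // -addrA lerD2l !nrmZ (ger0_norm t0) !exprMn t4.
  have -> : st (t%:C *: P) *a (t%:C *: P) + t%:C *: g *a (t%:C *: g) =
      s%:C *: (st P *a P + g *a g).
    by rewrite !cE -tt rmorphXn /=; lmod R[i]; ring.
  rewrite nrmZ (ger0_norm (ltW s0)).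
  have -> : 16 * (s ^+ 2 * nrm P ^+ 4) + s ^+ 2 * nrm g ^+ 4 = s ^+ 2 * C.
    by rewrite /C; ring.
  have h1 : s * nrm (st P *a P + g *a g) <= s * e by rewrite ler_pM2l.
  have h2 : s * e = (2 * n%:R)^-1 by rewrite /s; field; rewrite !gt_eqF.
  have h3 : s ^+ 2 * C <= n%:R^-1.
    have -> : s ^+ 2 * C = C / (4 * e ^+ 2) * n%:R ^- 2.
      by rewrite /s; field; rewrite !gt_eqF.
    apply: (@le_trans _ _ (n%:R * n%:R ^- 2)).
      by rewrite ler_wpM2r // invr_ge0 exprn_ge0.
    by rewrite expr2 invfM mulrA divff ?gt_eqF // mul1r.
  rewrite h2 invfM in h1; move: h1 h3; lra.
have hexp : (1 + 2 / n%:R) ^+ n <= expR 2 :> R.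
  apply: (@le_trans _ _ (expR (2 / n%:R) ^+ n)).
    by rewrite ler_pXn2r ?nnegrE ?expR_ge0 // expR_ge1Dx.
  by rewrite -expRM_natl mulrCA divff ?gt_eqF // mulr1.
have := le_trans h hexp.
have -> : n%:R * (s * nrm g ^+ 2) = nrm g ^+ 2 / (2 * e).
  by rewrite /s; field; rewrite !gt_eqF.
by rewrite ler_pdivrMr ?mulr_gt0 // /cs_const mulrCA mulrA.
Qed.

(** Apply the hermitian case to [g = q q'] and [P = p q']: then [P'P + g^2 = q (p'p + q'q) q'] and
    [|g| = |q|^2], so a factor [|q|^2] cancels. *)
Lemma nrm_sqr_le_add (p q : A) :
  nrm q ^+ 2 <= cs_const * nrm (st p *a p + st q *a q).
Proof.
have hg : st (q *a st q) = q *a st q by rewrite !cE.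
have := nrm_hermitian_le (p *a st q) hg.
have -> : st (p *a st q) *a (p *a st q) + q *a st q *a (q *a st q) =
    q *a (st p *a p + st q *a q) *a st q by rewrite !cE.
have -> : nrm (q *a st q) = nrm q ^+ 2.
  by rewrite -{1}(cstarK M q) nrm_star_mul nrm_star.
set w := st p *a p + _ => h; have q0 := nrm_ge0 q; have k0 := ltW cs_const_gt0.
have [->|q1] := eqVneq (nrm q) 0.
  by rewrite expr0n mulr_ge0 ?nrm_ge0.
have q2 : 0 < nrm q ^+ 2 by rewrite exprn_gt0 // lt_def q1.
rewrite -(ler_pM2r q2) -[X in X <= _]expr2; apply: (le_trans h).
rewrite -[X in _ <= X]mulrA ler_wpM2l //.
apply: (le_trans (nrmM _ _)); rewrite nrm_star.
apply: (le_trans (ler_wpM2r q0 (nrmM _ _))).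
by rewrite expr2 mulrA (mulrC (nrm w)).
Qed.

End CstarAlgebra.

(** * Hilbert modules *)

Section HilbertModule.
Variables (R : realType) (A : completeNormedModType R[i]) (M : cstar_alg A).
Variables (H : lmodType R[i]) (HM : hilbert_mod M H).
Local Notation "x *a y" := (cmul M x y) (at level 40, left associativity).
Local Notation st := (cstar M).
Local Notation dot := (ip HM).
Implicit Types (x y z : H) (r : R).

(** * Inner product calculus and the Cauchy-Schwarz inequality up to a constant *)

Lemma ipNr x y : (dot x (- y)) = - (dot x y).
Proof. by rewrite -scaleN1r ipZr scaleN1r. Qed.

Lemma ipDl x y z : (dot (x + y) z) = (dot x z) + (dot y z).
Proof. by rewrite !(ip_adj HM z) ipDr cstarD. Qed.

Lemma ipNl x y : (dot (- x) y) = - (dot x y).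
Proof. by rewrite !(ip_adj HM y) ipNr cstarN. Qed.

Lemma ipZlr r x y : (dot (r%:C *: x) y) = r%:C *: (dot x y).
Proof. by rewrite !(ip_adj HM y) ipZr cstarZr. Qed.

Lemma ipMl x y a : (dot (ract HM x a) y) = st a *a (dot x y).
Proof. by rewrite !(ip_adj HM y) ipMr cstarM. Qed.

Definition ipE := (ipDl, ipDr HM, ipNl, ipNr, ipZlr, ipZr HM).

Definition hnrm x : R := Num.sqrt (nrm (dot x x)).

Lemma hnrm_ge0 x : 0 <= hnrm x. Proof. exact: sqrtr_ge0. Qed.

Lemma sqr_hnrm x : hnrm x ^+ 2 = nrm (dot x x).
Proof. by rewrite sqr_sqrtr ?nrm_ge0. Qed.

Lemma hnormE x : hnorm HM x = (hnrm x)%:C.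
Proof.
by rewrite /hnorm normE -sqr_hnrm rmorphXn /= sqrCK // lecR hnrm_ge0.
Qed.

(** Expand the square of [x c - t y] with [c = <x, y>]. The cross terms are [- 2 t c'c]; moved
    across, they become the [q'q] of the preceding estimate. *)
Lemma nrm_ip_cauchy_schwarz x y : nrm (dot x y) <= cs_const R * hnrm x * hnrm y.
Proof.
set K := cs_const R; have K0 : 0 < K := cs_const_gt0 R.
set c := (dot x y); have c0 := nrm_ge0 c; have y0 := nrm_ge0 (dot y y).
have main t : 0 < t -> 2 * t * nrm c ^+ 2 <=
    K * (nrm (dot x x) * nrm c ^+ 2 + t ^+ 2 * nrm (dot y y)).
  move=> t0; have [p hp] := ip_pos HM (ract HM x c - t%:C *: y).
  pose q := (Num.sqrt (2 * t))%:C *: c.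
  have sq : Num.sqrt (2 * t) ^+ 2 = 2 * t by rewrite sqr_sqrtr // mulr_ge0 // ltW.
  have := nrm_sqr_le_add M p q.
  have -> : st p *a p + st q *a q =
      st c *a (dot x x) *a c + (t ^+ 2)%:C *: (dot y y).
    rewrite -hp /q !ipE !ipMl !ipMr -/c (ip_adj HM x y) -/c !cE.
    have sqC : (Num.sqrt (2 * t))%:C * (Num.sqrt (2 * t))%:C = 2 * t%:C :> R[i].
      by rewrite -rmorphM -expr2 sq rmorphM rmorph_nat.
    by rewrite rmorphXn /=; lmod R[i]; try ring; ring: sqC.
  rewrite nrmZ exprMn real_normK ?num_real // sq => h.
  apply: (le_trans h); rewrite ler_pM2l //; apply: (le_trans (nrmD _ _)).
  apply: lerD; last by rewrite nrmZ ger0_norm // sqr_ge0.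
  apply: (le_trans (nrmM _ _ _)); apply: (le_trans (ler_wpM2r c0 (nrmM _ _ _))).
  by rewrite nrm_star (mulrC (nrm c)) -mulrA -expr2.
have sqb : nrm c ^+ 2 <= K ^+ 2 * (nrm (dot x x) * nrm (dot y y)).
  suff key a : nrm (dot x x) < a -> nrm c ^+ 2 <= K ^+ 2 * (a * nrm (dot y y)).
    apply/ler_addgt0Pr => d d0.
    pose e := d / (K ^+ 2 * (nrm (dot y y) + 1)).
    have y1 : 0 < nrm (dot y y) + 1 by lra.
    have e0 : 0 < e by rewrite divr_gt0 // mulr_gt0 // exprn_gt0.
    have := key (nrm (dot x x) + e); rewrite ltrDl => /(_ e0) /le_trans; apply.
    rewrite mulrDl mulrDr lerD2l.
    have -> : d = K ^+ 2 * (e * (nrm (dot y y) + 1)).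
      by rewrite /e; field; rewrite !gt_eqF.
    by rewrite ler_pM2l ?exprn_gt0 // ler_pM2l // lerDl.
  move=> xa; have a0 : 0 < a by apply: le_lt_trans xa; exact: nrm_ge0.
  (* With [t = K a] the term in [<x, x>] absorbs at most half of the left side; [a > |<x, x>|] keeps
     [t] positive when [x = 0]. *)
  have Ka : 0 < K * a by rewrite mulr_gt0.
  have := main _ Ka.
  have : K * (nrm (dot x x) * nrm c ^+ 2) <= K * (a * nrm c ^+ 2).
    by rewrite ler_pM2l // ler_wpM2r ?sqr_ge0 // ltW.
  move=> h1 h2; rewrite -(ler_pM2l Ka).
  have -> : K * a * (K ^+ 2 * (a * nrm (dot y y))) =
    K * ((K * a) ^+ 2 * nrm (dot y y)) by ring.
  lra.
have Kx : 0 <= K * hnrm x * hnrm y by rewrite !mulr_ge0 ?hnrm_ge0 // ltW.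
rewrite -(@ler_pXn2r _ 2) ?nnegrE //.
have -> : (K * hnrm x * hnrm y) ^+ 2 = K ^+ 2 * (hnrm x ^+ 2 * hnrm y ^+ 2).
  by ring.
by rewrite !sqr_hnrm.
Qed.

(** * Averages of terms of the net *)

Section Net.
Variables (D : directed_set).

Definition eventually_net (P : D -> Prop) :=
  exists a0 : D, forall a, dle a0 a -> P a.

Lemma eventually_netI (P Q : D -> Prop) :
  eventually_net P -> eventually_net Q -> eventually_net (fun a => P a /\ Q a).
Proof.
move=> [a hP] [b hQ]; have [c [ac bc]] := dle_directed a b.
by exists c => d cd; split; [apply/hP/(dle_trans ac)|apply/hQ/(dle_trans bc)].
Qed.

Lemma eventually_net_ex (P : D -> Prop) : eventually_net P -> exists a, P a.
Proof. by move=> [a hP]; exists a; apply/hP/dle_refl. Qed.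

Lemma net_cvgP (f : D -> A) (l : A) : net_cvg f l <->
  forall e : R, 0 < e -> eventually_net (fun a => nrm (f a - l) < e).
Proof.
split=> h e e0.
  have [|a0 ha] := h e%:C; first by rewrite ltcR.
  by exists a0 => a /ha; rewrite normE ltcR.
move: e0; rewrite ltcE => /andP[/eqP /= im0 re0].
have [a0 ha] := h _ re0; exists a0 => a /ha.
by rewrite normE ltcE /= im0 eqxx.
Qed.

Variables (xi : H -> A) (xs : D -> H) (B : R) (L : A).
Hypothesis xiD : forall x y, xi (x + y) = xi x + xi y.
Hypothesis xiZ : forall (k : R[i]) x, xi (k *: x) = k *: xi x.
Hypothesis xsB : forall a, nrm (dot (xs a) (xs a)) <= B.
Hypothesis xs_cvg : forall x (e : R), 0 < e ->
  eventually_net (fun a => nrm (xi x - dot (xs a) x) < e).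
Hypothesis xi_cvg : forall e : R, 0 < e ->
  eventually_net (fun a => nrm (xi (xs a) - L) < e).

Let L2 : A := L + st L.

(** The next term [x] is taken so far out that [<x, S>] is near [xi S], hence near [n L]: the cross
    terms supply multiples of [L2], and the diagonal costs at most [2 B + |L2|]. Two test vectors
    let a later average be compared with an earlier one and with an arbitrary vector. *)
Lemma net_partial_sum (e : R) y1 y2 (n : nat) : 0 < e -> exists S : H,
  [/\ nrm ((2 : R)%:C *: dot S S - (n%:R ^+ 2 : R)%:C *: L2) <=
        n%:R * (2 * B + nrm L2) + 4 * n%:R ^+ 2 * e,
      nrm (xi S - (n%:R : R)%:C *: L) <= n%:R * e,
      nrm ((n%:R : R)%:C *: xi y1 - dot S y1) <= n%:R * e &
      nrm ((n%:R : R)%:C *: xi y2 - dot S y2) <= n%:R * e].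
Proof.
move=> e0; elim: n => [|n [S [h1 h2 h3 h4]]].
  have ip00 z : dot 0 z = 0 by rewrite -(scale0r 0) -[0 : R[i]]/(0%:C) ipZlr scale0r.
  have xi0 : xi 0 = 0 by rewrite -(scale0r 0) xiZ scale0r.
  exists 0; rewrite !ip00 xi0 expr0n /= !scale0r scaler0 !subr0 nrm0 !mul0r mulr0.
  by rewrite mul0r addr0.
have [a [[[g1 g2] g3] g4]] := eventually_net_ex (eventually_netI (eventually_netI
  (eventually_netI (xs_cvg S e0) (xi_cvg e0)) (xs_cvg y1 e0)) (xs_cvg y2 e0)).
pose x := xs a; exists (S + x); rewrite -[n.+1%:R]natr1; set N : R := n%:R.
have N0 : 0 <= N by rewrite ler0n.
split.
- have -> : (2 : R)%:C *: dot (S + x) (S + x) - ((N + 1) ^+ 2)%:C *: L2 =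
      ((2 : R)%:C *: dot S S - (N ^+ 2)%:C *: L2)
    + ((2 : R)%:C *: dot x x - L2)
    + (2 : R)%:C *: ((xi S - N%:C *: L) - (xi S - dot x S))
    + (2 : R)%:C *: st ((xi S - N%:C *: L) - (xi S - dot x S)).
    rewrite !cE !ipE (ip_adj HM x S) /L2 !rmorphXn !rmorphD rmorph1 !rmorph_nat /=.
    by lmod R[i]; ring.
  set w := _ - (xi S - _).
  have hw : nrm w <= N * e + e by apply: (le_trans (nrmB _ _)); rewrite lerD // ltW.
  have hx := xsB a; rewrite -/x in hx.
  apply: (le_trans (nrmD _ _)); apply: (le_trans (lerD (nrmD _ _) (lexx _))).
  apply: (le_trans (lerD (lerD (nrmD _ _) (lexx _)) (lexx _))).
  rewrite !nrmZ nrm_star ger0_norm //.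
  have := nrmB ((2 : R)%:C *: dot x x) L2; rewrite nrmZ ger0_norm //.
  have := mulr_ge0 N0 (ltW e0); move: h1; rewrite -/N; lra.
- have -> : xi (S + x) - (N + 1)%:C *: L = (xi S - N%:C *: L) + (xi x - L).
    by rewrite xiD rmorphD rmorph1; lmod R[i]; ring.
  by rewrite mulrDl mul1r; apply: (le_trans (nrmD _ _)); rewrite lerD // ltW.
- have -> : (N + 1)%:C *: xi y1 - dot (S + x) y1 =
    (N%:C *: xi y1 - dot S y1) + (xi y1 - dot x y1).
    by rewrite !ipE rmorphD rmorph1; lmod R[i]; ring.
  by rewrite mulrDl mul1r; apply: (le_trans (nrmD _ _)); rewrite lerD // ltW.
- have -> : (N + 1)%:C *: xi y2 - dot (S + x) y2 =
    (N%:C *: xi y2 - dot S y2) + (xi y2 - dot x y2).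
    by rewrite !ipE rmorphD rmorph1; lmod R[i]; ring.
  by rewrite mulrDl mul1r; apply: (le_trans (nrmD _ _)); rewrite lerD // ltW.
Qed.

Lemma net_average (e : R) y1 y2 : 0 < e -> exists z : H,
  [/\ nrm ((2 : R)%:C *: dot z z - L2) <= e, nrm (xi z - L) <= e,
      nrm (xi y1 - dot z y1) <= e & nrm (xi y2 - dot z y2) <= e].
Proof.
(* Once [C <= n d], the diagonal and cross errors total at most [5 d] after division by [n^2]. *)
move=> e0; pose C := 2 * B + nrm L2; pose d := e / 8.
have d0 : 0 < d by rewrite divr_gt0.
pose n := (Num.bound (`|C| / d)).+1; pose N : R := n%:R.
have N0 : 0 < N by rewrite ltr0n.
have CN : C <= N * d.
  rewrite -ler_pdivrMr //; apply: (@le_trans _ _ (`|C| / d)).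
    by rewrite ler_pM2r ?invr_gt0 // ler_norm.
  apply: (@le_trans _ _ (Num.bound (`|C| / d))%:R); last by rewrite ler_nat.
  by apply: ltW; apply: archi_boundP; apply: divr_ge0 => //; exact: ltW.
have [S [h1 h2 h3 h4]] := net_partial_sum y1 y2 n d0.
rewrite -/N -/C in h1 h2 h3 h4.
have NC : N%:C != 0 :> R[i] by rewrite fmorph_eq0 gt_eqF.
have Ni : 0 <= N^-1 by rewrite invr_ge0 ltW.
have scale_le w (c : R) : nrm (N%:C *: w) <= N * c -> nrm w <= c.
  by rewrite nrmZ gtr0_norm // ler_pM2l.
have de : d <= e by rewrite /d; lra.
exists ((N^-1)%:C *: S); split.
- apply: (scale_le); apply: (scale_le).
  have -> : N%:C *: (N%:C *: ((2 : R)%:C *: dot ((N^-1)%:C *: S) ((N^-1)%:C *: S) - L2)) =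
     (2 : R)%:C *: dot S S - (N ^+ 2)%:C *: L2.
    by rewrite !ipE rmorphXn fmorphV /=; move: N%:C NC => k k0; lmod R[i]; field.
  apply: (le_trans h1); have := ler_wpM2l (ltW N0) CN.
  have := mulr_ge0 (sqr_ge0 N) (ltW d0).
  have -> : e = 8 * d by rewrite /d; field.
  nra.
- apply: scale_le; apply: le_trans (ler_wpM2l (ltW N0) de).
  suff -> : N%:C *: (xi ((N^-1)%:C *: S) - L) = xi S - N%:C *: L by [].
  by rewrite xiZ fmorphV /=; move: N%:C NC => k k0; lmod R[i]; field.
- apply: scale_le; apply: le_trans (ler_wpM2l (ltW N0) de).
  suff -> : N%:C *: (xi y1 - dot ((N^-1)%:C *: S) y1) = N%:C *: xi y1 - dot S y1 by [].
  by rewrite !ipE fmorphV /=; move: N%:C NC => k k0; lmod R[i]; field.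
- apply: scale_le; apply: le_trans (ler_wpM2l (ltW N0) de).
  suff -> : N%:C *: (xi y2 - dot ((N^-1)%:C *: S) y2) = N%:C *: xi y2 - dot S y2 by [].
  by rewrite !ipE fmorphV /=; move: N%:C NC => k k0; lmod R[i]; field.
Qed.

(** The order of choices gives uniformity: [z] precedes [y], while [z'] depends on [y] and on the
    slack [t] and drops out at the end. *)
Lemma dual_approx (e : R) : 0 < e ->
  exists z : H, forall y, nrm (xi y - dot z y) <= e * hnrm y.
Proof.
move=> e0; set K := cs_const R; have K0 : 0 < K := cs_const_gt0 R.
pose c := e / K; have c0 : 0 < c by rewrite divr_gt0.
(* The four terms of [2 <w, w>] below add up to at most [10 d = 2 c^2]. *)
pose d := c ^+ 2 / 5; have d0 : 0 < d by rewrite divr_gt0 ?exprn_gt0.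
have [z [z1 z2 _ _]] := net_average 0 0 d0; exists z => y.
apply/ler_addgt0Pr => t t0.
pose d' := Num.min t d.
have d'0 : 0 < d' by rewrite lt_min t0.
have [z' [w1 w2 w3 w4]] := net_average z y d'0.
have d't : d' <= t by rewrite ge_min lexx.
have d'd : d' <= d by rewrite ge_min lexx orbT.
pose w := z' - z.
have hw : nrm (dot w w) <= c ^+ 2.
  have e1 : (2 : R)%:C *: dot w w = ((2 : R)%:C *: dot z' z' - L2)
     + ((2 : R)%:C *: dot z z - L2)
     + (2 : R)%:C *: ((xi z - dot z' z) - (xi z - L))
     + (2 : R)%:C *: st ((xi z - dot z' z) - (xi z - L)).
    rewrite /w !ipE (ip_adj HM z' z) /L2 !cE rmorph_nat.
    by lmod R[i]; ring.
  have : nrm ((2 : R)%:C *: dot w w) <= 10 * d.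
    rewrite e1; set v := _ - (xi z - L).
    have hv : nrm v <= 2 * d by apply: (le_trans (nrmB _ _)); lra.
    apply: (le_trans (nrmD _ _)); apply: (le_trans (lerD (nrmD _ _) (lexx _))).
    apply: (le_trans (lerD (lerD (nrmD _ _) (lexx _)) (lexx _))).
    rewrite !nrmZ nrm_star ger0_norm //; lra.
  rewrite nrmZ ger0_norm // /d; lra.
have hw' : hnrm w <= c.
  by rewrite -(@ler_pXn2r _ 2) ?nnegrE ?hnrm_ge0 ?(ltW c0) // sqr_hnrm.
have -> : xi y - dot z y = (xi y - dot z' y) + dot w y.
  by rewrite /w !ipE; lmod R[i]; ring.
rewrite [X in _ <= X]addrC; apply: (le_trans (nrmD _ _)).
apply: lerD; first exact: le_trans d't.
apply: (le_trans (nrm_ip_cauchy_schwarz _ _)); rewrite ler_wpM2r ?hnrm_ge0 //.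
have -> : e = K * c by rewrite /c mulrC divfK ?gt_eqF.
by rewrite ler_pM2l.
Qed.

End Net.

(** * Representing vectors as limits of approximate ones *)

Lemma eq0_of_nrm_le (a : A) : (forall e : R, 0 < e -> nrm a <= e) -> a = 0.
Proof.
move=> h; apply: nrm_eq0; apply/eqP; rewrite eq_le nrm_ge0 andbT.
by apply/ler_addgt0Pr => e /h; rewrite add0r.
Qed.

(** Testing two approximations [u m], [u n] on their own difference [w] bounds [|w|^2] by a small
    multiple of [|w|], so the sequence is Cauchy; Cauchy-Schwarz passes to the limit. *)
Lemma dual_representable (xi : H -> A) :
  (forall e : R, 0 < e ->
    exists z : H, forall y, nrm (xi y - dot z y) <= e * hnrm y) ->
  exists eta : H, forall y, xi y = dot eta y.
Proof.
move=> approx.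
have {approx} /choice[u hu] : forall n : nat, exists z : H,
    forall y, nrm (xi y - dot z y) <= n.+1%:R^-1 * hnrm y.
  by move=> n; apply: approx; rewrite invr_gt0 ltr0n.
have archi (e : R) : 0 < e -> exists N : nat, forall n, (N <= n)%N -> n.+1%:R^-1 < e.
  move=> e0; exists (Num.bound e^-1) => n hn.
  rewrite -[e]invrK ltf_pV2 ?posrE ?invr_gt0 ?ltr0n //.
  apply: (lt_le_trans (archi_boundP _)); first by rewrite invr_ge0 ltW.
  by rewrite ler_nat (leq_trans hn).
have cauchy m n : hnrm (u m - u n) <= m.+1%:R^-1 + n.+1%:R^-1.
  set w := u m - u n; have [->|w0] := eqVneq (hnrm w) 0.
    by rewrite addr_ge0 ?invr_ge0.
  have wp : 0 < hnrm w by rewrite lt_def w0 hnrm_ge0.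
  rewrite -(ler_pM2r wp) -[X in X <= _]expr2 sqr_hnrm.
  have -> : dot w w = (xi w - dot (u n) w) - (xi w - dot (u m) w).
    by rewrite {1}/w !ipE; lmod R[i]; ring.
  by apply: (le_trans (nrmB _ _)); rewrite mulrDl addrC lerD.
have [e e0|eta heta] := @hm_complete _ _ _ _ HM u.
  move: e0; rewrite ltcE => /andP[/eqP /= im0 re0].
  have [N hN] := archi (complex.Re e / 2) ltac:(by rewrite divr_gt0).
  exists N => m n /hN hm /hN hn; rewrite -/(hnorm HM _) hnormE ltcE /= im0 eqxx /=.
  by apply: (le_lt_trans (cauchy m n)); rewrite [X in _ < X]splitr ltrD.
have {}heta (e : R) : 0 < e -> exists N, forall n, (N <= n)%N -> hnrm (u n - eta) < e.
  move=> e0; have [|N hN] := heta e%:C; first by rewrite ltcR.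
  by exists N => n /hN; rewrite -/(hnorm HM _) hnormE ltcR.
exists eta => y; apply/eqP; rewrite -subr_eq0; apply/eqP/eq0_of_nrm_le => e e0.
have K0 := cs_const_gt0 R; have y0 := hnrm_ge0 y.
(* The two errors sum to [d (1 + K) |y|] with [K] the Cauchy-Schwarz constant; the added 1 covers
   [y = 0]. *)
pose d := e / ((1 + cs_const R) * (hnrm y + 1)).
have c0 : 0 < (1 + cs_const R) * (hnrm y + 1) by rewrite mulr_gt0 //; lra.
have d0 : 0 < d by rewrite divr_gt0.
have [N1 h1] := archi d d0; have [N2 h2] := heta d d0.
pose n := maxn N1 N2.
have -> : xi y - dot eta y = (xi y - dot (u n) y) + dot (u n - eta) y.
  by rewrite !ipE; lmod R[i]; ring.
apply: (le_trans (nrmD _ _)).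
have b1 : nrm (xi y - dot (u n) y) <= d * hnrm y.
  by apply: (le_trans (hu _ _)); rewrite ler_wpM2r // ltW // h1 // leq_maxl.
have b2 : nrm (dot (u n - eta) y) <= cs_const R * d * hnrm y.
  apply: (le_trans (nrm_ip_cauchy_schwarz _ _)); rewrite ler_wpM2r // ler_pM2l // ltW // h2 //.
  exact: leq_maxr.
have -> : e = d * ((1 + cs_const R) * (hnrm y + 1)) by rewrite /d divfK ?gt_eqF.
have := mulr_gt0 d0 K0; lra.
Qed.

End HilbertModule.

Theorem theorem5p5 (R : realType) (A : completeNormedModType R[i])
  (M : cstar_alg A) (H : lmodType R[i]) (HM : hilbert_mod M H)
  (xi : H -> A) (D : directed_set) (xs : D -> H) :
  in_dual HM xi ->
  (exists B : R[i], forall a, hnorm HM (xs a) <= B) ->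
  (forall x : H, net_cvg (fun a => xi x - ip HM (xs a) x) 0) ->
  (exists L : A, net_cvg (fun a => xi (xs a)) L) ->
  exists eta : H, (forall x, xi x = ip HM eta x) /\
    net_cvg (fun a => xi (xs a)) (ip HM eta eta).
Proof.
move=> [xiD xiZ _ _] [B hB] hx [L /net_cvgP hL].
have hx' x (e : R) : 0 < e ->
    eventually_net (fun a => nrm (xi x - ip HM (xs a) x) < e).
  move=> e0; have /net_cvgP/(_ _ e0)[a0 ha] := hx x.
  by exists a0 => a /ha; rewrite subr0.
have hB' a : nrm (ip HM (xs a) (xs a)) <= complex.Re B ^+ 2.
  have := hB a; rewrite hnormE lecE /= => /andP[_ h].
  rewrite -sqr_hnrm ler_pXn2r ?nnegrE ?hnrm_ge0 //.
  by apply: le_trans h; exact: hnrm_ge0.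
have [eta heta] := dual_representable (dual_approx xiD xiZ hB' hx' hL).
exists eta; split=> //; apply/net_cvgP => e e0.
(* The limit comes from the pointwise hypothesis at [eta] itself: [xi (xs a) = <eta, xs a>] is the
   adjoint of [<xs a, eta>]. *)
have [a0 ha] := hx' eta e e0; exists a0 => a /ha.
rewrite !heta.
have -> : ip HM eta (xs a) - ip HM eta eta =
    - cstar M (ip HM eta eta - ip HM (xs a) eta).
  by rewrite cstarD cstarN -!ip_adj opprB.
by rewrite nrmN nrm_star.
Qed.
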